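(* Suppose that (i) $g_0(\boldsymbol\gamma)$ is polyhedral with parameter $\rho=\Theta(1)>0$, i.e. $g_0(\boldsymbol\gamma_0^* )\ge g_0(\boldsymbol\gamma)+\rho\|\boldsymbol\gamma_0^*-\boldsymbol\gamma\|$ for all $\boldsymbol\gamma$, and (ii) the effective backlog process $\boldsymbol Q(t)$ has a countable state space under the algorithm OLAC. Then, under OLAC with control parameter $\boldsymbol\theta$, with probability 1, $$\overline q_{\mathrm{av}}=\sum_{j=1}^r\theta_j+O(1),$$ where $\overline q_{\mathrm{av}}=\limsup_{t\to\infty}\frac1t\sum_{\tau=0}^{t-1}\sum_{j=1}^r\mathbb E\{q_j(\tau)\}$.
   Context: **Model.** Time is slotted, $t=0,1,2,\dots$; there are $r\ge1$ queues. The network state $S(t)$ is i.i.d. over time with values in $\{s_1,\dots,s_M\}$, $\pi_{s_i}=\Pr\{S(t)=s_i\}$, $\boldsymbol\pi=(\pi_{s_1},\dots,\pi_{s_M})$. The controller observes $S(t)$ at the start of slot $t$ but does not know $\boldsymbol\pi$. If $S(t)=s_i$ it chooses an action $x(t)$ in a time-invariant compact set $\mathcal X^{(s_i)}$; an action $x$ gives cost $f(t)=f(s_i,x)$ (costs are all in $\mathbb R_+$, or all in $\mathbb R_-$ for reward maximization problems), traffic $A_j(t)=A_j(s_i,x)\ge0$ to queue $j$, and service $\mu_j(t)=\mu_j(s_i,x)\ge0$ to queue $j$. The magnitudes of all functions $f,A_j,\mu_j$ are bounded by a constant $\delta_{\max}\in(0,\infty)$, and the functions are known to the controller. Queues: $q_j(t+1)=\max[q_j(t)-\mu_j(t)+A_j(t),0]$,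 $\boldsymbol q(0)=\boldsymbol0$. A feasible policy is stable if $\overline q_{\mathrm{av}}<\infty$; $f^*_{\mathrm{av}}$ is the optimal (minimal) value of $\limsup_{t\to\infty}\frac1t\sum_{\tau<t}\mathbb E\{f(\tau)\}$ over all stable policies. **Dual functions.** $V\ge1$ is a parameter. For $\boldsymbol\gamma\in\mathbb R^r$, $g_{s_i}(\boldsymbol\gamma)=\inf_{x\in\mathcal X^{(s_i)}}\{Vf(s_i,x)+\sum_j\gamma_j[A_j(s_i,x)-\mu_j(s_i,x)]\}$ and $g(\boldsymbol\gamma)=\sum_{s_i}\pi_{s_i}g_{s_i}(\boldsymbol\gamma)$. $g_0$ denotes $g$ with $V=1$; $\boldsymbol\gamma^*$ and $\boldsymbol\gamma_0^*$ denote maximizers over $\boldsymbol\gamma\succeq\boldsymbol0$ of $g$ and $g_0$ respectively, with $\boldsymbol\gamma^*=V\boldsymbol\gamma_0^*$. $\|\cdot\|$ is the Euclidean norm. **Standing assumptions.** (A1) There is $\epsilon_s=\Theta(1)>0$ such that for every state distribution $\boldsymbol\pi'$ with $\|\boldsymbol\pi'-\boldsymbol\pi\|\le\epsilon_s$ there are actions $x_k^{(s_i)}\in\mathcal X^{(s_i)}$ and weights $\vartheta_k^{(s_i)}\ge0$, $k=1,2,\dots$, with $\sum_k\vartheta_k^{(s_i)}=1$ for all $s_i$ (possibly depending on $\boldsymbol\pi'$), with $\sum_{s_i}\pi'_{s_i}\sum_k\vartheta_k^{(s_i)}[A_j(s_i,x_k^{(s_i)})-\mu_j(s_i,x_k^{(s_i)})]\le-\eta_0$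 for all $j$, where $\eta_0=\Theta(1)>0$ is independent of $\boldsymbol\pi'$. (A2) There are actions $x_k^{(s_i)*}\in\mathcal X^{(s_i)}$ and weights $\vartheta_k^{(s_i)*}\ge0$ with $\sum_k\vartheta_k^{(s_i)*}=1$ for all $s_i$, such that $\sum_{s_i}\pi_{s_i}\sum_k\vartheta_k^{(s_i)*}f(s_i,x_k^{(s_i)*})=f^*_{\mathrm{av}}$ and $\sum_{s_i}\pi_{s_i}\sum_k\vartheta_k^{(s_i)*}[A_j(s_i,x_k^{(s_i)*})-\mu_j(s_i,x_k^{(s_i)*})]=0$ for all $j$. (A3) $\boldsymbol\gamma_0^*$ is the unique maximizer of $g_0$ in $\mathbb R^r$. **Algorithm OLAC** (parameter $\boldsymbol\theta=(\theta_1,\dots,\theta_r)>0$). Let $\pi_{s_i}(t)=N_{s_i}(t)/t$, where $N_{s_i}(t)$ is the number of slots in $\{0,\dots,t-1\}$ with $S=s_i$. In every slot $t$: (1) let $\boldsymbol\beta(t)$ be an optimal solution of $\max_{\boldsymbol\beta\succeq\boldsymbol0}g(\boldsymbol\beta,t)$, $g(\boldsymbol\beta,t):=\sum_{s_i}\pi_{s_i}(t)g_{s_i}(\boldsymbol\beta)$; (2) set the effective backlog $Q_j(t)=q_j(t)+\beta_j(t)-\theta_j$ and, if $S(t)=s_i$, choose $x\in\mathcal X^{(s_i)}$ maximizing $-Vf(s_i,x)+\sum_jQ_j(t)[\mu_j(s_i,x)-A_j(s_i,x)]$; (3) update the queues. $O(\cdot)$ and $\Theta(\cdot)$ are with respect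 to $V$; in particular $O(1)$, $\Theta(1)$ mean constants not depending on $V$. *)

(* Defs.v *)
From HB Require Import structures.
From mathcomp Require Import all_boot all_order all_algebra.
From mathcomp Require Import all_classical all_reals all_analysis.
Set Implicit Arguments.
Unset Strict Implicit.
Unset Printing Implicit Defensive.
Import Order.TTheory GRing.Theory Num.Theory.
Import numFieldNormedType.Exports.
Local Open Scope classical_set_scope.
Local Open Scope ring_scope.

(* The norm that the library puts on 'rV is the sup norm. *)
Definition enorm (R : realType) n (v : 'rV[R]_n) : R :=
  Num.sqrt (\sum_(j < n) v 0 j ^+ 2).

Definition dot (R : realType) n (u v : 'rV[R]_n) : R :=
  \sum_(j < n) u 0 j * v 0 j.

Definition nonneg_orthant (R : realType) n : set 'rV[R]_n :=
  [set v | forall j, 0 <= v 0 j].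

Definition prob_vector (R : realType) n (p : 'rV[R]_n) : Prop :=
  (forall i, 0 <= p 0 i) /\ \sum_(i < n) p 0 i = 1.

Definition argmax (R : realType) (U : Type) (D : set U) (h : U -> R) : set U :=
  [set a | D a /\ forall b, D b -> h b <= h a].

(* The state s_i is represented by its index i : 'I_M, and all the action sets
   live in one ambient topological space. *)
Record network (R : realType) (r M : nat) := Network {
  action : topologicalType;
  feasible : 'I_M -> set action;
  cost : 'I_M -> action -> R;
  arrival : 'I_M -> action -> 'rV[R]_r;
  service : 'I_M -> action -> 'rV[R]_r;
  dist : 'rV[R]_M;
  dmax : R;
  feasible_compact : forall i, compact (feasible i);
  dist_prob : prob_vector dist;
  dmax_gt0 : 0 < dmax;
  cost_bounded : forall i x, feasible i x -> `|cost i x| <= dmax;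
  cost_sign : (forall i x, feasible i x -> 0 <= cost i x) \/
              (forall i x, feasible i x -> cost i x <= 0);
  arrival_bounded : forall i x, feasible i x ->
    forall j, 0 <= arrival i x 0 j <= dmax;
  service_bounded : forall i x, feasible i x ->
    forall j, 0 <= service i x 0 j <= dmax
}.

Definition net_input R r M (N : network R r M) i (x : action N) : 'rV[R]_r :=
  arrival i x - service i x.

Definition dual_state R r M (N : network R r M) (V : R) (i : 'I_M)
    (gamma : 'rV[R]_r) : R :=
  inf [set V * cost i x + dot gamma (net_input i x) | x in @feasible R r M N i].

(* p is the true distribution for g, and the empirical one for g(., t). *)
Definition dual R r M (N : network R r M) (V : R) (p : 'rV[R]_M)
    (gamma : 'rV[R]_r) : R :=
  \sum_(i < M) p 0 i * dual_state N V i gamma.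

Definition dual0 R r M (N : network R r M) : 'rV[R]_r -> R :=
  dual N 1 (dist N).

Definition polyhedral (R : realType) n (h : 'rV[R]_n -> R) (a : 'rV[R]_n)
    (rho : R) : Prop :=
  forall gamma, h gamma + rho * enorm (a - gamma) <= h a.

Section processes.
Context (R : realType) (r M : nat) (N : network R r M).
Context (d : measure_display) (T : measurableType d) (P : probability T R).

Fixpoint queue (S : nat -> T -> 'I_M) (x : nat -> T -> action N) (t : nat)
    (w : T) : 'rV[R]_r :=
  if t is t'.+1 then
    \row_j Num.max (queue S x t' w 0 j - service (S t' w) (x t' w) 0 j
                    + arrival (S t' w) (x t' w) 0 j) 0
  else 0.

Definition time_average (u : nat -> \bar R) : \bar R :=
  limn_esup (fun t => ((t%:R^-1)%:E * \sum_(tau < t) u tau)%E).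

Definition qav (S : nat -> T -> 'I_M) (x : nat -> T -> action N) : \bar R :=
  time_average (fun tau => \sum_(j < r) 'E_P[fun w => queue S x tau w 0%R j])%E.

Definition fav (S : nat -> T -> 'I_M) (x : nat -> T -> action N) : \bar R :=
  time_average (fun tau => 'E_P[fun w => cost (S tau w) (x tau w)])%E.

Definition filtration (F : nat -> set_system T) : Prop :=
  [/\ forall t, sigma_algebra setT (F t),
      forall t, F t `<=` measurable &
      forall t, F t `<=` F t.+1].

Definition iid_states (S : nat -> T -> 'I_M) : Prop :=
  (forall t i, measurable [set w | S t w = i]) /\
  (forall n (s : 'I_n -> 'I_M),
     P [set w | forall k : 'I_n, S k w = s k] = (\prod_(k < n) dist N 0 (s k))%:E).

Definition rv_wrt (G : set_system T) (X : T -> R) : Prop :=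
  forall B : set R, measurable B -> G (X @^-1` B).

(* F t is the information available before S(t) is revealed, possibly
   including randomization by the controller; S(t) and the decision of slot t
   belong to F (t + 1). The action space carries no sigma-algebra, so the
   measurability requirement bears on the numerical processes it induces. *)
Definition policy (F : nat -> set_system T) (S : nat -> T -> 'I_M)
    (x : nat -> T -> action N) : Prop :=
  [/\ filtration F /\ iid_states S,
      forall t i, F t.+1 [set w | S t w = i],
      forall t i E, F t E ->
        P (E `&` [set w | S t w = i]) = (P E * (dist N 0 i)%:E)%E,
      forall t w, feasible (S t w) (x t w) &
      forall t, [/\ rv_wrt (F t.+1) (fun w => cost (S t w) (x t w)),
        forall j, rv_wrt (F t.+1) (fun w => arrival (S t w) (x t w) 0 j) &
        forall j, rv_wrt (F t.+1) (fun w => service (S t w) (x t w) 0 j)]].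

(* At t = 0 this is the zero vector, so that g(., 0) = 0. *)
Definition empirical (S : nat -> T -> 'I_M) (t : nat) (w : T) : 'rV[R]_M :=
  \row_i ((\sum_(u < t) (S u w == i))%N%:R / t%:R).

Definition backlog (theta : 'rV[R]_r) (S : nat -> T -> 'I_M)
    (x : nat -> T -> action N) (beta : nat -> T -> 'rV[R]_r) (t : nat) (w : T)
    : 'rV[R]_r :=
  queue S x t w + beta t w - theta.

(* In the first slots the empirical dual may be unbounded above or have no
   maximizer (the empirical distribution may be far from the true one); then
   beta(t) is left arbitrary. *)
Definition olac (V : R) (theta : 'rV[R]_r) (F : nat -> set_system T)
    (S : nat -> T -> 'I_M) (x : nat -> T -> action N)
    (beta : nat -> T -> 'rV[R]_r) : Prop :=
  [/\ policy F S x,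
      forall t j, rv_wrt (F t) (fun w => beta t w 0 j),
      forall t w,
        let best := argmax (@nonneg_orthant R r) (dual N V (empirical S t w)) in
        best !=set0 -> best (beta t w) &
      forall t w,
        argmax (@feasible R r M N (S t w))
          (fun y => - (V * cost (S t w) y)
             + dot (backlog theta S x beta t w)
                   (service (S t w) y - arrival (S t w) y))
          (x t w)].

Definition countable_state_space (Q : nat -> T -> 'rV[R]_r) : Prop :=
  exists2 D : set 'rV[R]_r, countable D & {ae P, forall w, forall t, D (Q t w)}.

End processes.

Definition fav_opt R r M (N : network R r M) : \bar R :=
  ereal_inf [set v | exists (d : measure_display) (T : measurableType d)
    (P : probability T R) (F : nat -> set_system T) (S : nat -> T -> 'I_M)
    (x : nat -> T -> action N),
    [/\ policy P F S x, (qav P S x < +oo)%E & v = fav P S x]].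

(* Countable randomization of actions in state i, with weights vartheta. *)
Definition mixture R r M (N : network R r M) (i : 'I_M) (vartheta : nat -> R)
    (x : nat -> action N) : Prop :=
  [/\ forall k, feasible i (x k), forall k, 0 <= vartheta k &
      series vartheta @ \oo --> (1 : R)].

Definition mean R r M (N : network R r M) (p : 'rV[R]_M)
    (vartheta : 'I_M -> nat -> R) (x : 'I_M -> nat -> action N)
    (h : 'I_M -> action N -> R) : R :=
  \sum_(i < M) p 0 i * limn (series (fun k => vartheta i k * h i (x i k))).

Definition slackness R r M (N : network R r M) : Prop :=
  exists eps_s eta0 : R, [/\ 0 < eps_s, 0 < eta0 &
    forall p : 'rV[R]_M, prob_vector p -> enorm (p - dist N) <= eps_s ->
    exists (vartheta : 'I_M -> nat -> R) (x : 'I_M -> nat -> action N),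
      (forall i, mixture i (vartheta i) (x i)) /\
      forall j, mean p vartheta x (fun i y => net_input i y 0 j) <= - eta0].

Definition optimal_mixture R r M (N : network R r M) : Prop :=
  exists (vartheta : 'I_M -> nat -> R) (x : 'I_M -> nat -> action N),
  [/\ forall i, mixture i (vartheta i) (x i),
      (mean (dist N) vartheta x (@cost R r M N))%:E = fav_opt N &
      forall j, mean (dist N) vartheta x (fun i y => net_input i y 0 j) = 0].

(* Main.v *)
Require Import Defs.
From mathcomp Require Import all_boot all_order all_algebra.
From mathcomp Require Import all_classical all_reals all_analysis.
From mathcomp Require Import measurable_realfun ring lra.
Import Order.TTheory GRing.Theory Num.Theory.
Import numFieldNormedType.Exports.
Local Open Scope classical_set_scope.
Local Open Scope ring_scope.

(* The sharp maximum of g at gs = V gamma0 is stable: as soon as the empirical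
   distribution is within a constant (independent of V) of the true one, gs is the
   unique maximizer of the empirical dual, so beta(t) = gs exactly. On this event
   Q(t) - gs = q(t) - theta, and since A - mu is a supergradient of g_{S(t)} at Q(t),
   polyhedrality gives |q(t) - theta|^2 an expected drift of at most
   - const * E|q(t) - theta| + O(1). On the complementary event
   |q(t) - theta| = O(t) + const, which is compensated by its probability being O(1/t)
   by Chebyshev's inequality. Telescoping bounds the time average of
   E|q(t) - theta| by a constant. *)

(** * The l1 norm and the scalar product *)

Definition l1 (R : realType) n (v : 'rV[R]_n) : R := \sum_(j < n) `|v 0 j|.
Arguments l1 {R n} v.

Section l1_norm.
Context (R : realType) (n : nat).
Implicit Types u v : 'rV[R]_n.

Lemma l1_ge0 v : 0 <= l1 v.
Proof. by apply: sumr_ge0 => j _; exact: normr_ge0. Qed.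

Lemma l1N v : l1 (- v) = l1 v.
Proof. by apply: eq_bigr => j _; rewrite mxE normrN. Qed.

Lemma l1D u v : l1 (u + v) <= l1 u + l1 v.
Proof.
rewrite -big_split /=; apply: ler_sum => j _; rewrite mxE; exact: ler_normD.
Qed.

Lemma dotDl u1 u2 v : dot (u1 + u2) v = dot u1 v + dot u2 v.
Proof. by rewrite -big_split; apply: eq_bigr => j _; rewrite mxE mulrDl. Qed.

Lemma dotBl u1 u2 v : dot (u1 - u2) v = dot u1 v - dot u2 v.
Proof.
by rewrite -sumrB; apply: eq_bigr => j _; rewrite !mxE mulrBl.
Qed.

Lemma dotZl a u v : dot (a *: u) v = a * dot u v.
Proof. by rewrite big_distrr; apply: eq_bigr => j _; rewrite mxE /= mulrA. Qed.

Lemma dotNr u v : dot u (- v) = - dot u v.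
Proof. by rewrite -sumrN; apply: eq_bigr => j _; rewrite mxE mulrN. Qed.

(** Duality between the l1 and sup norms. Net inputs are bounded coordinatewise by [dmax], so l1 is
    the natural norm on the multiplier side. *)
Lemma ler_dot_l1 u v c : (forall j, `|v 0 j| <= c) -> `|dot u v| <= c * l1 u.
Proof.
move=> vc; rewrite big_distrr; apply: le_trans (ler_norm_sum _ _ _) _.
by apply: ler_sum => j _; rewrite normrM mulrC ler_wpM2r.
Qed.

(** Each coordinate is at most the Euclidean norm. The crude factor [n] suffices, since it only
    replaces the slope [rho] by [rho / r]. *)
Lemma l1_le_enorm v : l1 v <= n%:R * enorm v.
Proof.
rewrite -[n in n%:R]card_ord mulr_natl -sumr_const; apply: ler_sum => j _.
rewrite -sqrtr_sqr ler_wsqrtr // (bigD1 j) //= lerDl.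
by apply: sumr_ge0 => k _; exact: sqr_ge0.
Qed.

End l1_norm.

(** * Lipschitz bounds, scaling in V and sharpness of the dual functions *)

Section dual_functions.
Context {R : realType} {r M : nat} (N : network R r M).
Hypothesis feasible_neq0 : forall i, @feasible R r M N i !=set0.
Implicit Types (V : R) (a b : 'rV[R]_r) (i : 'I_M) (x : action N).

Lemma net_input_bounded i x :
  feasible i x -> forall j, `|net_input i x 0 j| <= dmax N.
Proof.
move=> fx j; rewrite !mxE ler_norml.
have /andP[? ?] := arrival_bounded fx j.
have /andP[? ?] := service_bounded fx j.
by apply/andP; split; lra.
Qed.

Lemma dual_state_le V i a x : feasible i x ->
  dual_state N V i a <= V * cost i x + dot a (net_input i x).
Proof.
move=> fx; apply: ge_inf; last by exists x.
(* [inf] is a genuine lower bound only for sets bounded below; the bounds on cost and net input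
   provide one. *)
exists (- (`|V| * dmax N + dmax N * l1 a)) => _ [y fy <-].
rewrite lerNl; apply: le_trans (ler_norm _) _; rewrite normrN.
apply: le_trans (ler_normD _ _) _; apply: lerD.
  by rewrite normrM ler_wpM2l // (cost_bounded fy).
by apply: ler_dot_l1; exact: net_input_bounded.
Qed.

Lemma le_dual_state V i a c :
  (forall x : action N, feasible i x -> c <= V * cost i x + dot a (net_input i x)) ->
  c <= dual_state N V i a.
Proof.
move=> H; apply: lb_le_inf; last by move=> _ [x fx <-]; exact: H.
by have [x fx] := feasible_neq0 i; exists (V * cost i x + dot a (net_input i x)), x.
Qed.

(** An infimum of affine functions whose gradients are bounded by [dmax] in sup norm is
    [dmax]-Lipschitz in l1, whatever V is. *)
Lemma dual_state_lipschitz V i a b :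
  dual_state N V i a <= dual_state N V i b + dmax N * l1 (a - b).
Proof.
rewrite -lerBlDr; apply: le_dual_state => x fx; rewrite lerBlDr.
apply: le_trans (dual_state_le V i a x fx) _.
rewrite -[in leLHS](subrK b a) dotDl.
have /(ler_dot_l1 _ _ (a - b)) := net_input_bounded i x fx.
move=> /ler_normlW; lra.
Qed.

Lemma dual_state_dist V i a b :
  `|dual_state N V i a - dual_state N V i b| <= dmax N * l1 (a - b).
Proof.
rewrite ler_norml; apply/andP; split; last first.
  by rewrite lerBlDl dual_state_lipschitz.
by rewrite lerNl opprB lerBlDl -l1N opprB dual_state_lipschitz.
Qed.

(* The chosen action exposes a supergradient of the concave function g_i at a. *)
Lemma dual_state_supergradient V i a b x :
  argmax (@feasible R r M N i)
    (fun y => - (V * cost i y) + dot a (service i y - arrival i y)) x ->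
  dot (a - b) (net_input i x) <= dual_state N V i a - dual_state N V i b.
Proof.
move=> [fx xmax].
have : V * cost i x + dot a (net_input i x) <= dual_state N V i a.
  apply: le_dual_state => y /xmax.
  by rewrite /net_input -[service i y - _]opprB -[service i x - _]opprB !dotNr; lra.
have := dual_state_le V i b x fx; rewrite dotBl; lra.
Qed.

(** Scaling the multiplier together with the cost weight pulls the positive factor V out of the
    infimum. *)
Lemma dual_stateZ V i a : 0 < V ->
  dual_state N V i (V *: a) = V * dual_state N 1 i a.
Proof.
move=> V0; apply/eqP; rewrite eq_le; apply/andP; split; last first.
  apply: le_dual_state => x fx; rewrite dotZl -mulrDr ler_pM2l //.
  by have := dual_state_le 1 i a x fx; rewrite mul1r.
rewrite mulrC -ler_pdivrMr //; apply: le_dual_state => x fx.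
rewrite ler_pdivrMr //; have := dual_state_le V i (V *: a) x fx.
by rewrite dotZl; lra.
Qed.

Lemma dualZ V p a : 0 < V -> dual N V p (V *: a) = V * dual N 1 p a.
Proof.
move=> V0; rewrite /dual big_distrr; apply: eq_bigr => i _ /=.
by rewrite dual_stateZ // mulrCA.
Qed.

(** By homogeneity the dual values and the distance to the maximizer both scale by V, so the slope
    of the sharp maximum does not depend on V. The factor [1 / r] comes from comparing norms. *)
Lemma l1_polyhedral V gamma0 rho b : 0 < V ->
  (0 < r)%N -> 0 <= rho -> polyhedral (dual0 N) gamma0 rho ->
  dual N V (dist N) b + rho / r%:R * l1 (b - V *: gamma0)
    <= dual N V (dist N) (V *: gamma0).
Proof.
move=> V0 r0 rho0 poly.
have -> : b = V *: (V^-1 *: b) by rewrite scalerA divff ?gt_eqF // scale1r.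
set c := V^-1 *: b; rewrite -scalerBr !dualZ //.
have -> : l1 (V *: (c - gamma0)) = V * l1 (gamma0 - c).
  rewrite -l1N -scalerN opprB /l1 big_distrr; apply: eq_bigr => j _.
  by rewrite mxE normrM gtr0_norm.
rewrite mulrCA -mulrDr ler_pM2l //; apply: le_trans (poly c).
have r0' : (0 : R) < r%:R by rewrite ltr0n.
rewrite lerD2l -mulrA ler_wpM2l // ler_pdivrMl //; exact: l1_le_enorm.
Qed.

(* Perturbing the weights by delta changes differences of the dual function by at most
   delta * dmax * |b - gs|, which the sharp maximum at gs absorbs. *)
Lemma argmax_dual_stable V gs (rho : R) p :
  nonneg_orthant gs ->
  (forall b, dual N V (dist N) b + rho * l1 (b - gs) <= dual N V (dist N) gs) ->
  dmax N * l1 (p - dist N) < rho ->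
  argmax (@nonneg_orthant R r) (dual N V p) = [set gs].
Proof.
move=> gs0 sharp small.
have key b : dual N V p b
    <= dual N V p gs - (rho - dmax N * l1 (p - dist N)) * l1 (b - gs).
  have E c : dual N V p c = dual N V (dist N) c
      + \sum_i (p - dist N) 0 i * dual_state N V i c.
    rewrite /dual -big_split; apply: eq_bigr => i _ /=; rewrite !mxE; ring.
  rewrite (E b) (E gs).
  have : \sum_i (p - dist N) 0 i * dual_state N V i b
      - \sum_i (p - dist N) 0 i * dual_state N V i gs
      <= dmax N * l1 (b - gs) * l1 (p - dist N).
    rewrite -sumrB big_distrr; apply: ler_sum => i _.
    rewrite -mulrBr; apply: le_trans (ler_norm _) _.
    by rewrite normrM mulrC ler_wpM2r // dual_state_dist.
  have := sharp b; nra.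
have gsmax b : dual N V p b <= dual N V p gs.
  apply: le_trans (key b) _; rewrite gerBl mulr_ge0 ?l1_ge0 // subr_ge0; exact: ltW.
apply/seteqP; split=> [b [b0 bmax]|_ -> ]; last by split.
have := le_trans (bmax _ gs0) (key b); rewrite -subr_ge0 addrAC subrr sub0r oppr_ge0.
rewrite pmulr_rle0 ?subr_gt0 // => l10.
have : l1 (b - gs) == 0 by rewrite eq_le l10 l1_ge0.
rewrite psumr_eq0 => [/allP H|j _]; last exact: normr_ge0.
apply/rowP => j; apply/eqP; rewrite -subr_eq0 -normr_eq0.
by have := H j (mem_index_enum _); rewrite !mxE.
Qed.

End dual_functions.

(** * Bounded random variables and linearity of their real-valued integrals *)

Definition bounded_rv {R : realType} {d} {T : measurableType d} (X : T -> R) : Prop :=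
  measurable_fun setT X /\ exists c, forall w, `|X w| <= c.

Section bounded_random_variables.
Context {R : realType} {d} {T : measurableType d}.
Implicit Types X Y : T -> R.

Lemma bounded_rv_cst (c : R) : bounded_rv (fun _ : T => c).
Proof. by split; [exact: measurable_cst|exists `|c|]. Qed.

Lemma bounded_rvD X Y : bounded_rv X -> bounded_rv Y ->
  bounded_rv (fun w => X w + Y w).
Proof.
move=> [mX [c Xc]] [mY [c' Yc']]; split; first exact: measurable_funD.
by exists (c + c') => w; apply: le_trans (ler_normD _ _) _; exact: lerD.
Qed.

Lemma bounded_rvM X Y : bounded_rv X -> bounded_rv Y ->
  bounded_rv (fun w => X w * Y w).
Proof.
move=> [mX [c Xc]] [mY [c' Yc']]; split; first exact: measurable_funM.
by exists (c * c') => w; rewrite normrM ler_pM.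
Qed.

Lemma bounded_rvN X : bounded_rv X -> bounded_rv (fun w => - X w).
Proof.
move=> [mX [c Xc]]; split; first exact: measurable_funN.
by exists c => w; rewrite normrN.
Qed.

Lemma bounded_rvB X Y : bounded_rv X -> bounded_rv Y ->
  bounded_rv (fun w => X w - Y w).
Proof. by move=> bX bY; apply: bounded_rvD => //; exact: bounded_rvN. Qed.

Lemma bounded_rvX X n : bounded_rv X -> bounded_rv (fun w => X w ^+ n).
Proof.
move=> bX; elim: n => [|n IH]; first exact: bounded_rv_cst.
have -> : (fun w => X w ^+ n.+1) = (fun w => X w * X w ^+ n).
  by apply/funext => w; rewrite exprS.
exact: bounded_rvM.
Qed.

Lemma bounded_rv_norm X : bounded_rv X -> bounded_rv (fun w => `|X w|).
Proof.
move=> [mX [c Xc]]; split; first exact: measurableT_comp.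
by exists c => w; rewrite normr_id.
Qed.

Lemma bounded_rv_max X Y : bounded_rv X -> bounded_rv Y ->
  bounded_rv (fun w => Num.max (X w) (Y w)).
Proof.
move=> [mX [c Xc]] [mY [c' Yc']]; split; first exact: measurable_maxr.
exists (Num.max c c') => w; rewrite le_max.
by case: (leP (X w) (Y w)) => _; rewrite ?Xc ?Yc' ?orbT.
Qed.

Lemma bounded_rv_sum (I : Type) (s : seq I) (X : I -> T -> R) :
  (forall i, bounded_rv (X i)) -> bounded_rv (fun w => \sum_(i <- s) X i w).
Proof.
move=> bX; elim: s => [|i s IH].
  rewrite (_ : (fun _ => _) = fun=> 0); first exact: bounded_rv_cst.
  by apply/funext => w; rewrite big_nil.
rewrite (_ : (fun _ => _) = fun w => X i w + \sum_(i <- s) X i w).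
  exact: bounded_rvD.
by apply/funext => w; rewrite big_cons.
Qed.

Lemma bounded_rv_indic (A : set T) : measurable A -> bounded_rv (\1_A : T -> R).
Proof.
move=> mA; split; first exact: measurable_indic.
by exists 1 => w; rewrite indicE; case: (_ \in _); rewrite ?normr1 ?normr0.
Qed.

(** No measurability of [h] is needed: a preimage is a countable union of level sets of [k]. *)
Lemma bounded_rv_comp_countable (K : countType) (k : T -> K) (h : K -> R) :
  (forall a, measurable [set w | k w = a]) ->
  (exists c, forall w, `|h (k w)| <= c) -> bounded_rv (fun w => h (k w)).
Proof.
move=> mk hc; split=> // _ B mB; rewrite setTI.
rewrite (_ : _ @^-1` B = \bigcup_(a in [set a | B (h a)]) [set w | k w = a]).
  rewrite bigcup_mkcond; apply: countable_bigcupT_measurable => [|a].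
    exact: countableP.
  by case: ifP.
by apply/seteqP; split=> [w Bw|w [a /= Ba] kw]; [exists (k w)|rewrite /preimage /= kw].
Qed.

Context (P : probability T R).

(** This motivates the class: at each fixed time all processes below are bounded, so integrability
    follows from closure under algebraic operations. *)
Lemma bounded_rv_integrable X : bounded_rv X -> P.-integrable setT (EFin \o X).
Proof.
move=> [mX [c Xc]]; apply: measurable_bounded_integrable => //.
  by rewrite (le_lt_trans (probability_le1 P measurableT)) ?ltry.
exists c; split; first exact: num_real.
by move=> x cx w _; exact: le_trans (Xc w) (ltW cx).
Qed.

Lemma bounded_rv_expectation X : bounded_rv X ->
  ('E_P[X] = (\int[P]_w X w)%:E)%E.
Proof.
move=> bX; rewrite unlock /Rintegral fineK //.
by apply: integrable_fin_num => //; exact: bounded_rv_integrable.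
Qed.

Lemma le_Rintegral_bounded X Y : bounded_rv X -> bounded_rv Y ->
  (forall w, X w <= Y w) -> \int[P]_w X w <= \int[P]_w Y w.
Proof.
by move=> bX bY XY; apply: le_Rintegral => //; exact: bounded_rv_integrable.
Qed.

Lemma Rintegral_boundedD X Y : bounded_rv X -> bounded_rv Y ->
  \int[P]_w (X w + Y w) = \int[P]_w X w + \int[P]_w Y w.
Proof.
by move=> bX bY; apply: RintegralD => //; exact: bounded_rv_integrable.
Qed.

Lemma Rintegral_boundedB X Y : bounded_rv X -> bounded_rv Y ->
  \int[P]_w (X w - Y w) = \int[P]_w X w - \int[P]_w Y w.
Proof.
by move=> bX bY; apply: RintegralB => //; exact: bounded_rv_integrable.
Qed.

Lemma Rintegral_boundedZ c X : bounded_rv X ->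
  \int[P]_w (c * X w) = c * \int[P]_w X w.
Proof.
by move=> bX; apply: RintegralZl => //; exact: bounded_rv_integrable.
Qed.

Lemma Rintegral_prob_cst (c : R) : \int[P]_w c = c.
Proof.
rewrite Rintegral_cst // (_ : fine _ = 1) ?mulr1 //.
exact: (congr1 fine (probability_setT P)).
Qed.

Lemma Rintegral_bounded_sum (I : Type) (s : seq I) (X : I -> T -> R) :
  (forall i, bounded_rv (X i)) ->
  \int[P]_w (\sum_(i <- s) X i w) = \sum_(i <- s) \int[P]_w X i w.
Proof.
move=> bX; elim: s => [|i s IH].
  by under eq_Rintegral do rewrite big_nil; rewrite Rintegral_prob_cst big_nil.
under eq_Rintegral do rewrite big_cons.
by rewrite Rintegral_boundedD ?big_cons ?IH //; exact: bounded_rv_sum.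
Qed.

End bounded_random_variables.

(** * Product formula for an event independent of a sub-sigma-algebra *)

Section sub_sigma_algebra.
Context {R : realType} {d} {T : measurableType d} (P : probability T R).
Context (G : set_system T) (sG : sigma_algebra setT G) (subG : G `<=` measurable).
(** The same carrier with [G] as its sigma-algebra, so that [G]-measurability becomes ordinary
    [measurable_fun]. *)
Let TG : measurableType _ := g_sigma_algebraType G.

Lemma measurable_sub (A : set T) : G A -> measurable (A : set TG).
Proof. exact: sub_sigma_algebra. Qed.

Lemma sub_measurable (A : set T) : measurable (A : set TG) -> G A.
Proof. by rewrite (measurable_g_measurableTypeE sG). Qed.

Lemma rv_wrtP (X : T -> R) : rv_wrt G X <-> measurable_fun setT (X : TG -> R).
Proof.
split=> [H _ B mB|H B mB].
  by rewrite setTI; apply: measurable_sub; exact: H.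
by apply: sub_measurable; rewrite -[X in measurable X]setTI; exact: H.
Qed.

Lemma bounded_rv_sub (X : T -> R) : bounded_rv (X : TG -> R) -> bounded_rv X.
Proof.
move=> [mX bX]; split=> // _ B mB; rewrite setTI; apply: subG.
by have /rv_wrtP := mX; apply.
Qed.

Context (A : set T) (mA : measurable A) (c : R) (c0 : 0 <= c).
Hypothesis indep : forall E, G E -> P (E `&` A) = (P E * c%:E)%E.

Let phi : T -> TG := id.
Let mphi : measurable_fun setT phi.
Proof. by move=> _ B mB; rewrite setTI; apply: subG; exact: sub_measurable. Qed.

(** The pushforward along the identity is the restriction of [mu] to [G]. The existential hands over
    a measure structure together with an equation for its values. *)
Let trace_measure (mu : {measure set T -> \bar R}) :
  exists nu : {measure set TG -> \bar R}, nu = pushforward mu phi :> (set TG -> \bar R).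
Proof.
by unshelve refine (ex_intro _ (pushforward mu phi : {measure set TG -> \bar R}) _).
Qed.

(** By [indep] the measures sending E to [P (E]&[A)] and to [c * P E] agree on [G], hence give
    [G]-measurable functions the same integral. *)
Lemma ge0_integral_indep (X : T -> R) :
  measurable_fun setT (X : TG -> R) -> (forall w, 0 <= X w) ->
  (\int[P]_(w in A) (X w)%:E = c%:E * \int[P]_w (X w)%:E)%E.
Proof.
move=> mX X0.
have mX' : measurable_fun setT (fun w => (X w)%:E).
  apply/measurable_EFinP => _ B mB; rewrite setTI; apply: subG.
  by have /rv_wrtP := mX; apply.
transitivity (\int[mrestr P mA]_w (X w)%:E)%E.
  rewrite [RHS](@ge0_negligible_integral _ _ _ _ _ (~` A)) ?setTD ?setCK //.
  - by apply: eq_measure_integral => B mB BA; rewrite /= /mrestr setIidl.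
  - exact: measurableC.
  - by move=> x _; rewrite lee_fin.
  - by rewrite /= /mrestr setICl measure0.
have c0' : (c = (NngNum c0)%:num) by [].
rewrite [in RHS]c0'.
have [mu1 E1] := trace_measure (mrestr P mA).
have [mu2 E2] := trace_measure P.
transitivity (\int[mu1]_w (X w)%:E)%E.
  by rewrite E1 (ge0_integral_pushforward mphi) //;
    [exact/measurable_EFinP|move=> y _; rewrite lee_fin].
transitivity (\int[mscale (NngNum c0) mu2]_w (X w)%:E)%E.
  apply: eq_measure_integral => B mB _.
  rewrite E1 /= /mscale /= E2 /mrestr /pushforward muleC; apply: indep.
  exact: sub_measurable.
rewrite ge0_integral_mscale //; [|exact/measurable_EFinP|by move=> y _; rewrite lee_fin].
by rewrite E2 (ge0_integral_pushforward mphi) //;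
  [exact/measurable_EFinP|move=> y _; rewrite lee_fin].
Qed.

Lemma Rintegral_indep (X : T -> R) : bounded_rv (X : TG -> R) ->
  \int[P]_w (X w * \1_A w) = c * \int[P]_w X w.
Proof.
move=> bX; have bX' := bounded_rv_sub _ bX.
have [mX [k Xk]] := bX.
have bA : bounded_rv (fun w => \1_A w : R) by exact: bounded_rv_indic.
(* Adding the bound [k] makes the variable nonnegative; the formula for [X] is the one for [Y] minus
   the one for the constant [k]. *)
pose Y w := X w + k.
have Y0 w : 0 <= Y w by rewrite /Y -lerBlDr sub0r; have /ler_normlP[] := Xk w; lra.
have bY : bounded_rv Y by apply: bounded_rvD => //; exact: bounded_rv_cst.
have mY : measurable_fun setT (Y : TG -> R).
  by apply: measurable_funD => //; exact: measurable_cst.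
have key (Z : T -> R) : measurable_fun setT (Z : TG -> R) -> bounded_rv Z ->
    (forall w, 0 <= Z w) ->
    \int[P]_w (Z w * \1_A w) = c * \int[P]_w Z w.
  move=> mZ bZ Z0; transitivity (\int[P]_(w in A) Z w).
    rewrite [RHS]Rintegral_mkcond; apply: eq_Rintegral => w _.
    by rewrite patchE indicE; case: (_ \in _); rewrite ?mulr1 ?mulr0.
  rewrite /Rintegral ge0_integral_indep // fineM //.
  exact: (integrable_fin_num measurableT (bounded_rv_integrable P Z bZ)).
have k0 : 0 <= k := le_trans (normr_ge0 _) (Xk point).
have bk : bounded_rv (fun _ : T => k) := bounded_rv_cst k.
have mk : measurable_fun setT ((fun=> k) : TG -> R) by exact: measurable_cst.
have := key Y mY bY Y0; have := key _ mk bk (fun=> k0).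
rewrite [\int[P]_w Y w]Rintegral_boundedD //.
under [\int[P]_w (Y w * _)]eq_Rintegral do rewrite mulrDl.
by rewrite Rintegral_boundedD; [lra|exact: bounded_rvM|exact: bounded_rvM].
Qed.

End sub_sigma_algebra.

(** * Upper limits of time averages and telescoping of a drift inequality *)

Section averages.
Context {R : realType}.

Lemma limn_esup_near_bound (u : nat -> R) (a c : R) n0 :
  (forall t, (n0 <= t)%N -> `|u t - a| <= c) ->
  (`|limn_esup (fun t => (u t)%:E) - a%:E| <= c%:E)%E.
Proof.
move=> uc.
have lo : ((a - c)%:E <= limn_esup (fun t => (u t)%:E))%E.
  rewrite limn_esup_lim; apply: lime_ge; first exact: is_cvg_esups.
  apply: nearW => n; apply: le_trans (_ : (u (maxn n n0))%:E <= _)%E.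
    rewrite lee_fin; have := uc (maxn n n0) (leq_maxr _ _).
    by rewrite ler_norml => /andP[? _]; lra.
  by apply: ereal_sup_ubound; exists (maxn n n0) => //=; exact: leq_maxl.
have hi : (limn_esup (fun t => (u t)%:E) <= (a + c)%:E)%E.
  rewrite limn_esup_lim; apply: lime_le; first exact: is_cvg_esups.
  exists n0 => // n /= n0n; apply: ge_ereal_sup => _ [k /= nk <-].
  rewrite lee_fin; have := uc k (leq_trans n0n nk).
  by rewrite ler_norml => /andP[_ ?]; lra.
case: limn_esup lo hi => [l||]; rewrite ?leey ?leeNy_eq ?leye_eq //=.
by rewrite !lee_fin => lo hi; rewrite ler_norml; apply/andP; split; lra.
Qed.

Lemma time_average_near (a m : nat -> R) (l c : R) n0 :
  (forall t, `|a t - l| <= m t) ->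
  (forall t, (n0 <= t)%N -> \sum_(tau < t) m tau <= t%:R * c) ->
  (`|time_average (fun t => (a t)%:E) - l%:E| <= c%:E)%E.
Proof.
move=> am mc; rewrite /time_average.
under eq_fun do rewrite sumEFin -EFinM.
(* The shift to [n0.+1] keeps t positive, so that division by t is genuine. *)
apply: (limn_esup_near_bound _ _ _ n0.+1) => t n0t.
have t0 : (0 : R) < t%:R by rewrite ltr0n (leq_ltn_trans _ n0t).
have -> : t%:R^-1 * \sum_(tau < t) a tau - l = t%:R^-1 * \sum_(tau < t) (a tau - l).
  rewrite sumrB sumr_const card_ord mulrBr -[X in _ - _ * X]mulr_natl mulKf //.
  by rewrite gt_eqF.
rewrite normrM gtr0_norm ?invr_gt0 // ler_pdivrMl //.
apply: le_trans (mc _ (ltnW n0t)); apply: le_trans (ler_norm_sum _ _ _) _.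
exact: ler_sum.
Qed.

(** Summing the drift from [n0] on cancels the intermediate [Phi]. The initial contribution [K]
    influences only the threshold [n1], not the limiting bound; hence the final constant is free of
    [theta]. *)
Lemma drift_telescope (Phi m : nat -> R) (c rho : R) n0 :
  0 < rho -> 0 <= c -> (forall t, 0 <= Phi t) ->
  (forall t, (n0 <= t)%N -> Phi t.+1 + 2 * rho * m t <= Phi t + c) ->
  exists n1, forall t, (n1 <= t)%N ->
    \sum_(tau < t) m tau <= t%:R * (c / (2 * rho) + 1).
Proof.
move=> rho0 c0 Phi0 drift.
pose K := `|2 * rho * \sum_(tau < n0) m tau + Phi n0|.
have tele k : 2 * rho * \sum_(tau < n0 + k) m tau + Phi (n0 + k)%N <= K + k%:R * c.
  elim: k => [|k IH]; first by rewrite addn0 mul0r addr0 ler_norm.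
  rewrite addnS big_ord_recr /= -natr1.
  by have := drift (n0 + k)%N (leq_addr _ _); nra.
(* From here on [K <= 2 * rho * t], which is paid for by the summand 1 in the bound. *)
exists (n0 + (Num.truncn (K / (2 * rho))).+1)%N => t n1t.
have r0 : 0 < 2 * rho by lra.
have n0t : (n0 <= t)%N := leq_trans (leq_addr _ _) n1t.
have Kt : K <= 2 * rho * t%:R.
  rewrite -ler_pdivrMl // mulrC; apply: le_trans (ltW (truncnS_gt _)) _.
  by rewrite ler_nat (leq_trans _ n1t) // leq_addl.
have := tele (t - n0)%N; rewrite subnKC // => H.
have ct : (t - n0)%:R * c <= t%:R * c by rewrite ler_wpM2r // ler_nat leq_subr.
rewrite -(ler_pM2l r0).
have -> : 2 * rho * (t%:R * (c / (2 * rho) + 1)) = t%:R * c + 2 * rho * t%:R.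
  by field; rewrite gt_eqF.
by have := Phi0 t; lra.
Qed.

(** Cauchy-Schwarz against the constant vector, obtained from
    [a i * a j <= (a i ^+ 2 + a j ^+ 2) / 2]. *)
Lemma sqr_sum_le n (a : 'I_n -> R) :
  (\sum_i a i) ^+ 2 <= n%:R * \sum_i a i ^+ 2.
Proof.
rewrite expr2 big_distrl /=.
apply: le_trans (_ : \sum_i \sum_j (a i ^+ 2 / 2 + a j ^+ 2 / 2) <= _).
  apply: ler_sum => i _; rewrite big_distrr /=; apply: ler_sum => j _.
  by have := sqr_ge0 (a i - a j); nra.
have -> : n%:R * \sum_i a i ^+ 2
    = \sum_(i < n) (n%:R * (a i ^+ 2 / 2) + \sum_j a j ^+ 2 / 2).
  rewrite big_split /= sumr_const card_ord -mulr_sumr -!mulr_suml -mulr_natl.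
  by field.
apply: ler_sum => i _.
by rewrite big_split /= sumr_const card_ord mulr_natl.
Qed.

End averages.

(** * The queue process under OLAC: measurability, growth and pathwise drift *)

Section olac_drift.
Context {R : realType} {r M : nat} (N : network R r M).
Context {d : measure_display} {T : measurableType d} (P : probability T R).
Context (F : nat -> set_system T) (S : nat -> T -> 'I_M) (x : nat -> T -> action N).
Hypothesis pol : policy P F S x.
Context (V : R) (theta gs : 'rV[R]_r) (rho : R).
Hypothesis feasible_neq0 : forall i, @feasible R r M N i !=set0.
Hypothesis theta_ge0 : forall j, 0 <= theta 0 j.
Hypothesis gs_ge0 : nonneg_orthant gs.
Hypothesis rho_gt0 : 0 < rho.
Hypothesis sharp :
  forall b, dual N V (dist N) b + rho * l1 (b - gs) <= dual N V (dist N) gs.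
Context (beta : nat -> T -> 'rV[R]_r).
Hypothesis olacH : olac P V theta F S x beta.

Let sF t : sigma_algebra setT (F t).
Proof. by case: pol => -[[]]. Qed.

Let subF t : F t `<=` measurable.
Proof. by case: pol => -[[]]. Qed.

Let FS t : F t `<=` F t.+1.
Proof. by case: pol => -[[]]. Qed.

Let rvF t (X : T -> R) : Prop := @bounded_rv R _ (g_sigma_algebraType (F t)) X.

Let rvF_rv t X : rvF t X -> bounded_rv X.
Proof. exact: (bounded_rv_sub _ (sF t) (subF t)). Qed.

Let rvFS t X : rvF t X -> rvF t.+1 X.
Proof.
move=> [mX bX]; split=> //; apply/(rv_wrtP _ (sF t.+1)) => B mB; apply: FS.
by have /(rv_wrtP _ (sF t)) := mX; apply.
Qed.

Let bounded_rvF t (X : T -> R) c :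
  rv_wrt (F t) X -> (forall w, `|X w| <= c) -> rvF t X.
Proof. by move=> mX Xc; split; [exact/rv_wrtP|exists c]. Qed.

Let q := queue S x.
Let m t w := l1 (q t w - theta).
(** Quadratic Lyapunov function centred at [theta], the level of q at which the effective backlog
    equals [gs] once [beta] does. *)
Let Phi t w := \sum_(j < r) (q t w 0 j - theta 0 j) ^+ 2.
Let net t w := net_input (S t w) (x t w).
Let L := \sum_(j < r) theta 0 j.

Let xfeasible t w : feasible (S t w) (x t w).
Proof. by case: pol. Qed.

Let arr t w j : 0 <= arrival (S t w) (x t w) 0 j <= dmax N.
Proof. exact: arrival_bounded. Qed.

Let ser t w j : 0 <= service (S t w) (x t w) 0 j <= dmax N.
Proof. exact: service_bounded. Qed.

Let queue_ge0 t w j : 0 <= q t w 0 j.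
Proof. by case: t => [|t]; rewrite /q /= mxE // le_max lexx orbT. Qed.

Let queue_le t w j : q t w 0 j <= t%:R * dmax N.
Proof.
elim: t => [|t IH]; first by rewrite /q /= mxE mul0r.
rewrite /q /= mxE ge_max -natr1 mulrDl mul1r.
have := arr t w j; have := ser t w j => /andP[s0 _] /andP[a0 aD].
have := dmax_gt0 N; have : (0 : R) <= t%:R by rewrite ler0n.
rewrite -/q => ? ?; apply/andP; split; last by nra.
by move: IH; rewrite /q; lra.
Qed.

Let rvF_queue t j : rvF t (fun w => q t w 0 j).
Proof.
elim: t => [|t IH].
  rewrite (_ : (fun _ => _) = fun=> 0); first exact: bounded_rv_cst.
  by apply/funext => w; rewrite /q /= mxE.
rewrite (_ : (fun _ => _) = fun w => Num.max (q t w 0 j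
    - service (S t w) (x t w) 0 j + arrival (S t w) (x t w) 0 j) 0); last first.
  by apply/funext => w; rewrite /q /= mxE.
case: pol => _ _ _ _ /(_ t) [_ /(_ j) mA /(_ j) mS].
apply: bounded_rv_max; last exact: bounded_rv_cst.
apply: bounded_rvD; last first.
  apply: (bounded_rvF _ _ (dmax N)) => // w.
  by have /andP[? ?] := arr t w j; rewrite ger0_norm.
apply: bounded_rvB; first exact: rvFS.
apply: (bounded_rvF _ _ (dmax N)) => // w.
by have /andP[? ?] := ser t w j; rewrite ger0_norm.
Qed.

Let rvF_m t : rvF t (m t).
Proof.
apply: bounded_rv_sum => j; apply: bounded_rv_norm.
rewrite (_ : (fun _ => _) = fun w => q t w 0 j - theta 0 j).
  by apply: bounded_rvB; [exact: rvF_queue|exact: bounded_rv_cst].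
by apply/funext => w; rewrite !mxE.
Qed.

Let rvF_Phi t : rvF t (Phi t).
Proof.
apply: bounded_rv_sum => j; apply: bounded_rvX; apply: bounded_rvB.
  exact: rvF_queue.
exact: bounded_rv_cst.
Qed.

(** A pathwise bound, valid in bad slots too; its linear growth is what a bad-slot probability of
    order [1 / t] must offset. *)
Let m_le t w : m t w <= t%:R * (r%:R * dmax N) + L.
Proof.
rewrite (_ : t%:R * (r%:R * dmax N) = \sum_(j < r) t%:R * dmax N); last first.
  by rewrite sumr_const card_ord -[RHS]mulr_natl mulrCA.
rewrite -big_split /=.
apply: ler_sum => j _; rewrite !mxE; apply: le_trans (ler_normB _ _) _.
by apply: lerD; rewrite ger0_norm.
Qed.

Let net_bound t w j : `|net t w 0 j| <= dmax N.
Proof. exact: net_input_bounded. Qed.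

(** Truncation at 0 moves a coordinate no further from [theta], as [theta] is nonnegative; expanding
    the square leaves the cross term and at most [dmax ^+ 2] per coordinate. *)
Let Phi_drift t w :
  Phi t.+1 w <= Phi t w + 2 * dot (q t w - theta) (net t w) + r%:R * dmax N ^+ 2.
Proof.
rewrite (_ : r%:R * dmax N ^+ 2 = \sum_(j < r) dmax N ^+ 2); last first.
  by rewrite sumr_const card_ord -[RHS]mulr_natl.
rewrite /dot big_distrr /= -!big_split /=; apply: ler_sum => j _.
set y := q t w 0 j; rewrite !mxE -/y.
have := net_bound t w j; rewrite !mxE.
set a := arrival _ _ _ _; set s := service _ _ _ _ => /ler_normlP[n1 n2].
have sq : (a - s) ^+ 2 <= dmax N ^+ 2 by nra.
have th := theta_ge0 j.
have : (Num.max (y - s + a) 0 - theta 0 j) ^+ 2 <= (y - s + a - theta 0 j) ^+ 2.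
  by case: (leP (y - s + a) 0) => // ?; nra.
by rewrite /q /=; nra.
Qed.

(** * Second moments of the state counts and the probability of a bad slot *)

Let count i t w : R := \sum_(u < t) (S u w == i)%:R.
Let deviation i t w : R := count i t w - t%:R * dist N 0 i.

Let state_event i t : F t.+1 [set w | S t w = i].
Proof. by case: pol. Qed.

Let indicE_state i t : (fun w => (S t w == i)%:R) = \1_[set w | S t w = i] :> (T -> R).
Proof.
apply/funext => w; rewrite indicE; congr ((nat_of_bool _)%:R).
by apply/idP/idP; rewrite inE => /eqP.
Qed.

Let rvF_state i t : rvF t.+1 (fun w => (S t w == i)%:R).
Proof.
rewrite indicE_state; apply: bounded_rv_indic; apply: measurable_sub.
exact: state_event.
Qed.

Let rvF_deviation i t : rvF t (deviation i t).
Proof.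
apply: bounded_rvB; last exact: bounded_rv_cst.
elim: t => [|t IH].
  rewrite (_ : count i 0 = fun=> 0); first exact: bounded_rv_cst.
  by apply/funext => w; rewrite /count big_ord0.
rewrite (_ : count i t.+1 = fun w => count i t w + (S t w == i)%:R).
  by apply: bounded_rvD; [exact: rvFS|exact: rvF_state].
by apply/funext => w; rewrite /count big_ord_recr.
Qed.

Let indep i t X : rvF t X ->
  \int[P]_w (X w * (S t w == i)%:R) = dist N 0 i * \int[P]_w X w.
Proof.
move=> bX; have [_ _ ind _ _] := pol.
rewrite -(Rintegral_indep P (F t) (sF t) (subF t) [set w | S t w = i]) //.
- by apply: eq_Rintegral => w _; rewrite -indicE_state.
- exact/subF/state_event.
- by case: (dist_prob N).
- by move=> E FE; exact: ind.
Qed.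

(** The new centred indicator is independent of the past, so the cross term has mean zero, and its
    own square is at most 1. *)
Let deviation_sqr i t : \int[P]_w (deviation i t w ^+ 2) <= t%:R.
Proof.
have dist01 : 0 <= dist N 0 i <= 1.
  have [p0 p1] := dist_prob N; rewrite p0 -p1 (bigD1 i) //= lerDl.
  by apply: sumr_ge0 => j _; exact: p0.
elim: t => [|t IH].
  under eq_Rintegral do rewrite /deviation /count big_ord0 mul0r subrr expr0n /=.
  by rewrite Rintegral_prob_cst.
have bD := rvF_rv _ _ (rvF_deviation i t).
have bS := rvF_rv _ _ (rvF_state i t).
have bc := @bounded_rv_cst R d T.
set D := deviation i t in bD IH *; set p := dist N 0 i in dist01 *.
apply: le_trans (_ : \int[P]_w (D w ^+ 2
  + (2 * (D w * (S t w == i)%:R - p * D w) + 1)) <= _).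
  apply: le_Rintegral_bounded => [||w].
  - exact/bounded_rvX/rvF_rv/rvF_deviation.
  - apply: bounded_rvD; first exact: bounded_rvX.
    apply: bounded_rvD => //; apply: bounded_rvM => //.
    by apply: bounded_rvB; apply: bounded_rvM.
  - have -> : deviation i t.+1 w = D w + ((S t w == i)%:R - p).
      by rewrite /D /deviation /count big_ord_recr /= -natr1 /p; ring.
    by case: (S t w == i) => /=; nra.
rewrite Rintegral_boundedD; [|exact: bounded_rvX|]; last first.
  apply: bounded_rvD => //; apply: bounded_rvM => //.
  by apply: bounded_rvB; apply: bounded_rvM.
rewrite Rintegral_boundedD //; last first.
  by apply: bounded_rvM => //; apply: bounded_rvB; apply: bounded_rvM.
rewrite Rintegral_boundedZ; last by apply: bounded_rvB; apply: bounded_rvM.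
rewrite Rintegral_boundedB; [|exact: bounded_rvM|exact: bounded_rvM].
rewrite Rintegral_boundedZ // Rintegral_prob_cst indep; last exact: rvF_deviation.
by rewrite subrr mulr0 add0r -natr1 lerD2r.
Qed.

(** Exactly the smallness condition under which [argmax_dual_stable] pins the empirical maximizer to
    [gs]. *)
Let good t w : bool := dmax N * l1 (empirical R S t w - dist N) < rho.
Let bad t w : R := (~~ good t w)%:R.

Let empiricalE t w i : (0 < t)%N ->
  t%:R * (empirical R S t w - dist N) 0 i = deviation i t w.
Proof.
move=> t0; rewrite !mxE mulrBr mulrC divfK; last by rewrite pnatr_eq0 -lt0n.
by rewrite /deviation /count natr_sum.
Qed.

Let rvF_bad t : rvF t (bad t).
Proof.
have mY : rvF t (fun w => dmax N * l1 (empirical R S t w - dist N)).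
  (* At time 0 the inverse of 0 is 0, so the empirical vector is the constant 0. *)
  case: t => [|t].
    rewrite (_ : (fun _ => _) = fun=> dmax N * l1 (0 - dist N)).
      exact: bounded_rv_cst.
    apply/funext => w; congr (_ * l1 (_ - _)).
    by apply/rowP => i; rewrite !mxE invr0 mulr0.
  apply: bounded_rvM; first exact: bounded_rv_cst.
  apply: bounded_rv_sum => i; apply: bounded_rv_norm.
  rewrite (_ : (fun _ => _) = fun w => t.+1%:R^-1 * deviation i t.+1 w).
    by apply: bounded_rvM; [exact: bounded_rv_cst|exact: rvF_deviation].
  by apply/funext => w; rewrite -empiricalE // mulKf // pnatr_eq0.
rewrite (_ : bad t = \1_((fun w => dmax N * l1 (empirical R S t w - dist N))
    @^-1` [set y | rho <= y])).
  apply: bounded_rv_indic; apply: measurable_sub.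
  have [/(rv_wrtP _ (sF t)) + _] := mY; apply.
  rewrite (_ : [set y | rho <= y] = `[rho, +oo[%classic); first exact: measurable_itv.
  by apply/seteqP; split=> y /=; rewrite in_itv /= andbT.
apply/funext => w; rewrite indicE /bad /good -leNgt; congr ((nat_of_bool _)%:R).
by apply/idP/idP; rewrite inE.
Qed.

(** One factor [M] comes from Cauchy-Schwarz over the states, the other from adding up M second
    moments. *)
Let K : R := dmax N ^+ 2 * M%:R ^+ 2 / rho ^+ 2.

(** Chebyshev: in a bad slot [t * rho] is at most [dmax] times the sum of the absolute deviations.
    Squaring and integrating compares [t ^+ 2] with second moments of order t. *)
Let bad_prob t : (0 < t)%N -> t%:R * \int[P]_w bad t w <= K.
Proof.
move=> t0; have t0' : (0 : R) < t%:R by rewrite ltr0n.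
have bb := rvF_rv _ _ (rvF_bad t).
have bD i := rvF_rv _ _ (rvF_deviation i t).
have D0 := dmax_gt0 N.
have : \int[P]_w ((t%:R ^+ 2 * rho ^+ 2) * bad t w)
    <= \int[P]_w ((dmax N ^+ 2 * M%:R) * \sum_i deviation i t w ^+ 2).
  apply: le_Rintegral_bounded => [||w].
  - by apply: bounded_rvM => //; exact: bounded_rv_cst.
  - apply: bounded_rvM; first exact: bounded_rv_cst.
    by apply: bounded_rv_sum => i; exact: bounded_rvX.
  - rewrite /bad /good -leNgt.
    case: (leP rho (dmax N * l1 (empirical R S t w - dist N))) => [H|_] /=; last first.
      rewrite mulr0n mulr0 mulr_ge0 ?sumr_ge0 // => [|i _]; last exact: sqr_ge0.
      by rewrite mulr_ge0 ?sqr_ge0.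
    rewrite mulr1n mulr1 -exprMn -mulrA.
    apply: le_trans (_ : (dmax N * \sum_i `|deviation i t w|) ^+ 2 <= _).
      rewrite ler_sqr ?nnegrE; last 2 first.
      - by rewrite mulr_ge0 // ltW.
      - by rewrite mulr_ge0 ?sumr_ge0 // ltW.
      rewrite -(ler_pM2l t0') mulrCA in H.
      apply: le_trans H _; rewrite ler_wpM2l //; first exact: ltW.
      rewrite /l1 big_distrr /=; apply: ler_sum => i _.
      by rewrite -empiricalE // normrM (gtr0_norm t0').
    rewrite exprMn ler_wpM2l ?sqr_ge0 //.
    have := sqr_sum_le _ (fun i => `|deviation i t w|).
    by under [X in _ <= _ * X]eq_bigr do rewrite real_normK ?num_real //.
rewrite Rintegral_boundedZ // Rintegral_boundedZ; last first.
  by apply: bounded_rv_sum => i; exact: bounded_rvX.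
rewrite Rintegral_bounded_sum; last by move=> i; exact: bounded_rvX.
have : \sum_i \int[P]_w (deviation i t w ^+ 2) <= M%:R * t%:R.
  rewrite mulr_natl -[M in X in _ <= X]card_ord -sumr_const.
  by apply: ler_sum => i _; exact: deviation_sqr.
set E := \int[P]_w _; set W := \sum_i _ => WM H.
rewrite /K ler_pdivlMr ?exprn_gt0 // -(ler_pM2l t0').
apply: le_trans (_ : t%:R ^+ 2 * rho ^+ 2 * E <= _); first lra.
apply: le_trans H _.
apply: le_trans (_ : dmax N ^+ 2 * M%:R * (M%:R * t%:R) <= _).
  by rewrite ler_wpM2l // mulr_ge0 ?sqr_ge0.
lra.
Qed.

(* A coordinatewise rounding of q costs O(1) and spares us the measurability of the
   dual functions, which are only evaluated at countably many points. *)
Let qt t w : {ffun 'I_r -> nat} := [ffun j => Num.truncn (q t w 0 j)].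
Let vec (k : {ffun 'I_r -> nat}) : 'rV[R]_r := \row_j (k j)%:R.
(** Change of the i-th dual function from [gs] to the rounded effective backlog of a good slot; at
    [qt t] it depends on the past only. *)
Let h i k := dual_state N V i (vec k - theta + gs) - dual_state N V i gs.

Let l1_qt t w : l1 (q t w - vec (qt t w)) <= r%:R.
Proof.
rewrite (_ : r%:R = \sum_(j < r) (1 : R)); last by rewrite sumr_const card_ord.
apply: ler_sum => j _; rewrite !mxE ffunE.
have /andP[? H] := truncn_itv (queue_ge0 t w j).
by rewrite ger0_norm ?subr_ge0 // lerBlDl natr1 ltW.
Qed.

Let rvF_h i t : rvF t (fun w => h i (qt t w)).
Proof.
apply: bounded_rv_comp_countable => [k|].
  rewrite (_ : [set _ | _] = \bigcap_(j in [set: 'I_r])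
      ((fun w => q t w 0 j) @^-1` `[(k j)%:R, (k j).+1%:R[)).
    apply: fin_bigcap_measurable => // j _; apply: measurable_sub.
    by have [/(rv_wrtP _ (sF t)) + _] := rvF_queue t j; apply; exact: measurable_itv.
  apply/seteqP; split=> w /=.
    by move=> <- j _ /=; rewrite in_itv /= ffunE; exact: truncn_itv.
  move=> H; apply/ffunP => j; rewrite ffunE; apply: truncn_def.
  by have := H j I; rewrite /= in_itv.
exists (dmax N * (r%:R + (t%:R * (r%:R * dmax N) + L))) => w.
have D0 := dmax_gt0 N; apply: le_trans (dual_state_dist _ feasible_neq0 _ _ _ _) _.
rewrite addrK ler_wpM2l ?(ltW D0) //.
rewrite (_ : vec _ - theta = - (q t w - vec (qt t w)) + (q t w - theta)); last first.
  by rewrite opprB addrA subrK.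
by apply: le_trans (l1D _ _ _ _) _; rewrite l1N; apply: lerD; [exact: l1_qt|exact: m_le].
Qed.

(** * Drift under the decisions of OLAC, pathwise and then in expectation *)

Let good_beta t w : good t w -> beta t w = gs.
Proof.
move=> g; have [_ _ /(_ t w) + _] := olacH.
rewrite /= (argmax_dual_stable _ feasible_neq0 _ gs rho) //.
by apply; exists gs.
Qed.

(** In a good slot the supergradient inequality between Q(t) and [gs] applies, with rounding error
    [dmax * r]; in a bad slot only the crude bound [dmax * m] is used. The sum of indicators
    isolates S(t) for the later use of independence. *)
Let drift_le t w : dot (q t w - theta) (net t w) <=
  \sum_i ((1 - bad t w) * h i (qt t w)) * (S t w == i)%:R
  + (dmax N * r%:R + dmax N * (bad t w * m t w)).
Proof.
have D0 := dmax_gt0 N.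
rewrite (bigD1 (S t w)) //= eqxx mulr1 big1 ?addr0; last first.
  by move=> i /negbTE; rewrite eq_sym => ->; rewrite mulr0.
rewrite /bad; have [g|_] := boolP (good t w); last first.
  rewrite /= subrr mul0r add0r mul1r; apply: ler_wpDl; first by rewrite mulr_ge0 // ltW.
  apply: le_trans (ler_norm _) _; apply: ler_dot_l1 => j; exact: net_bound.
rewrite /= subr0 mul1r mul0r mulr0 addr0.
have [_ _ _ /(_ t w)] := olacH; rewrite /backlog (good_beta _ _ g) -/q.
move=> /(dual_state_supergradient _ feasible_neq0 _ _ _ gs).
rewrite [X in dot X _](_ : _ = q t w - theta); last by rewrite addrAC addrK.
move=> H; apply: le_trans H _.
have := dual_state_lipschitz _ feasible_neq0 V (S t w) (q t w + gs - theta)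
  (vec (qt t w) - theta + gs).
rewrite (_ : _ - _ - _ = q t w - vec (qt t w)); last first.
  by apply/rowP => j; rewrite !mxE; ring.
have := ler_wpM2l (ltW D0) (l1_qt t w); rewrite /h; lra.
Qed.

(** Averaging over the true distribution assembles the functions of the single states into g, where
    sharpness at [gs] applies. *)
Let mean_h k : \sum_i dist N 0 i * h i k <= - rho * l1 (vec k - theta).
Proof.
rewrite /h; under eq_bigr do rewrite mulrBr.
rewrite sumrB; have := sharp (vec k - theta + gs); rewrite addrK /dual; lra.
Qed.

(** Independence replaces the indicator of each state by its probability, after which [mean_h]
    applies pointwise. Rounding costs [rho * r]; the term in [bad] restores the decrease missing in
    bad slots. *)
Let drift_expectation t :
  \int[P]_w (\sum_i ((1 - bad t w) * h i (qt t w)) * (S t w == i)%:R)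
  <= rho * r%:R + rho * \int[P]_w (bad t w * m t w) - rho * \int[P]_w m t w.
Proof.
have bc := @bounded_rv_cst R d T.
have bb := rvF_rv _ _ (rvF_bad t); have bm := rvF_rv _ _ (rvF_m t).
have bS i := rvF_rv _ _ (rvFS _ _ (rvF_h i t)).
have bX i : rvF t (fun w => (1 - bad t w) * h i (qt t w)).
  apply: bounded_rvM; last exact: rvF_h.
  by apply: bounded_rvB; [exact: bounded_rv_cst|exact: rvF_bad].
have bX' i := rvF_rv _ _ (bX i).
have bmul : bounded_rv (fun w => bad t w * m t w) by exact: bounded_rvM.
rewrite Rintegral_bounded_sum; last first.
  by move=> i; apply: bounded_rvM => //; exact: rvF_rv (rvF_state i t).
under eq_bigr do rewrite indep // -Rintegral_boundedZ //.
rewrite -Rintegral_bounded_sum; last by move=> i; exact: bounded_rvM.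
rewrite -!Rintegral_boundedZ // -[rho * r%:R](Rintegral_prob_cst P).
rewrite -Rintegral_boundedD //; last by apply: bounded_rvM.
rewrite -Rintegral_boundedB //; last by apply: bounded_rvM.
  apply: le_Rintegral_bounded => [||w].
  - by apply: bounded_rv_sum => i; exact: bounded_rvM.
  - by apply: bounded_rvB; [apply: bounded_rvD => //|]; exact: bounded_rvM.
  rewrite (_ : \sum_i _ = (1 - bad t w) * \sum_i dist N 0 i * h i (qt t w)); last first.
    by rewrite big_distrr; apply: eq_bigr => i _ /=; rewrite mulrCA.
  have := mean_h (qt t w).
  have : m t w <= l1 (vec (qt t w) - theta) + r%:R.
    rewrite addrC; apply: le_trans (_ : l1 (q t w - vec (qt t w))
      + l1 (vec (qt t w) - theta) <= _); last by rewrite lerD2r l1_qt.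
    by apply: le_trans (l1D _ _ _ _); rewrite addrA subrK.
  move=> /(ler_wpM2l (ltW rho_gt0)).
  have : 0 <= rho * r%:R by rewrite mulr_ge0 // ltW.
  by rewrite /bad; case: (good t w); rewrite /= ?mulr0n ?mulr1n; lra.
by apply: bounded_rvD => //; exact: bounded_rvM.
Qed.

(** Once t exceeds [L], the growth bound on [m] is at most [t * (r * dmax + 1)], and [bad_prob]
    cancels the factor t. Waiting for such t removes [theta] from the bound. *)
Let bad_m t : (0 < t)%N -> L <= t%:R ->
  \int[P]_w (bad t w * m t w) <= (r%:R * dmax N + 1) * K.
Proof.
move=> t0 Lt.
have bb := rvF_rv _ _ (rvF_bad t); have bm := rvF_rv _ _ (rvF_m t).
have t0' : (0 : R) < t%:R by rewrite ltr0n.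
have B0 : 0 <= r%:R * dmax N + 1 by rewrite addr_ge0 ?mulr_ge0 // ltW ?dmax_gt0.
apply: le_trans (ler_wpM2l B0 (bad_prob _ t0)); rewrite mulrA -Rintegral_boundedZ //.
apply: le_Rintegral_bounded => [||w]; first exact: bounded_rvM.
  by apply: bounded_rvM => //; exact: bounded_rv_cst.
rewrite mulrC ler_wpM2r //; apply: le_trans (m_le t w) _.
by rewrite mulrDl mul1r [X in _ <= X + _]mulrC lerD2l.
Qed.

(** Collects the squared net inputs, the rounding errors and the bad slots. V, [theta] and [gs] do
    not occur, which is what O(1) requires. *)
Definition drift_constant : R :=
  r%:R * dmax N ^+ 2 + 2 * (dmax N * r%:R + rho * r%:R
  + (rho + dmax N) * ((r%:R * dmax N + 1) * K)).

Let Phi_expectation t : (0 < t)%N -> L <= t%:R ->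
  \int[P]_w Phi t.+1 w + 2 * rho * \int[P]_w m t w
  <= \int[P]_w Phi t w + drift_constant.
Proof.
move=> t0 Lt; have D0 := dmax_gt0 N.
have bc := @bounded_rv_cst R d T.
have bb := rvF_rv _ _ (rvF_bad t); have bm := rvF_rv _ _ (rvF_m t).
have bPhi := rvF_rv _ _ (rvF_Phi t).
pose G w := \sum_i ((1 - bad t w) * h i (qt t w)) * (S t w == i)%:R.
have bG : bounded_rv G.
  apply: bounded_rv_sum => i; apply: bounded_rvM; last exact: rvF_rv (rvF_state i t).
  by apply: bounded_rvM; [exact: bounded_rvB|exact: rvF_rv (rvF_h i t)].
have bmul : bounded_rv (fun w => bad t w * m t w) by exact: bounded_rvM.
have bGm : bounded_rv (fun w => G w + dmax N * (bad t w * m t w)).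
  by apply: bounded_rvD => //; exact: bounded_rvM.
have : \int[P]_w Phi t.+1 w <= \int[P]_w (Phi t w
    + (2 * (G w + dmax N * (bad t w * m t w))
    + (2 * (dmax N * r%:R) + r%:R * dmax N ^+ 2))).
  apply: le_Rintegral_bounded => [||w]; first exact: rvF_rv (rvF_Phi t.+1).
    by apply: bounded_rvD => //; apply: bounded_rvD => //; exact: bounded_rvM.
  by have := Phi_drift t w; have := drift_le t w; rewrite -/(G w); lra.
rewrite Rintegral_boundedD //; last first.
  by apply: bounded_rvD => //; exact: bounded_rvM.
rewrite Rintegral_boundedD //; last exact: bounded_rvM.
rewrite Rintegral_boundedZ // Rintegral_prob_cst Rintegral_boundedD //; last first.
  exact: bounded_rvM.
rewrite Rintegral_boundedZ //.
have := drift_expectation t; rewrite -/(G _); have := bad_m t t0 Lt.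
rewrite /drift_constant; set e := \int[P]_w (bad t w * m t w); set k := _ * K.
move=> ek GE H.
have : (rho + dmax N) * e <= (rho + dmax N) * k by rewrite ler_wpM2l // addr_ge0 ?ltW.
move: GE H; lra.
Qed.

Lemma qav_near_theta :
  (`|qav P S x - (\sum_(j < r) theta 0 j)%:E| <= (drift_constant / (2 * rho) + 1)%:E)%E.
Proof.
have D0 := dmax_gt0 N.
have [n1 Hn1] : exists n1, forall t, (n1 <= t)%N ->
    \sum_(tau < t) \int[P]_w m tau w <= t%:R * (drift_constant / (2 * rho) + 1).
  (* The starting time [(Num.truncn L).+1] is positive and above [L], as the expected drift
     inequality demands. *)
  apply: (drift_telescope (fun t => \int[P]_w Phi t w) (fun t => \int[P]_w m t w)
    _ _ (Num.truncn L).+1) => //.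
  - rewrite /drift_constant /K !(addr_ge0, mulr_ge0, sqr_ge0, ler0n, invr_ge0) //;
      exact: ltW.
  - by move=> t; apply: Rintegral_ge0 => w _; apply: sumr_ge0 => j _; exact: sqr_ge0.
  - move=> t n0t; apply: Phi_expectation; first exact: leq_ltn_trans n0t.
    by apply: le_trans (ltW (truncnS_gt L)) _; rewrite ler_nat.
have bq t j := rvF_rv _ _ (rvF_queue t j).
rewrite /qav (_ : (fun _ => _) = fun t => (\sum_(j < r) \int[P]_w q t w 0 j)%:E); last first.
  apply/funext => t; rewrite -sumEFin; apply: eq_bigr => j _.
  exact: bounded_rv_expectation.
apply: (time_average_near _ (fun t => \int[P]_w m t w) _ _ n1) => // t.
rewrite -Rintegral_bounded_sum // -[X in _ - X](Rintegral_prob_cst P).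
rewrite -Rintegral_boundedB; [|exact: bounded_rv_sum|exact: bounded_rv_cst].
apply: (le_trans (le_normr_Rintegral _ _)) => //.
  apply: bounded_rv_integrable; apply: bounded_rvB; last exact: bounded_rv_cst.
  exact: bounded_rv_sum.
apply: le_Rintegral_bounded => [||w]; last first.
- rewrite -sumrB; apply: le_trans (ler_norm_sum _ _ _) _.
  by apply: ler_sum => j _; rewrite !mxE.
- exact: rvF_rv (rvF_m t).
- apply: bounded_rv_norm; apply: bounded_rvB; last exact: bounded_rv_cst.
  exact: bounded_rv_sum.
Qed.

End olac_drift.

Theorem theorem1 (R : realType) (r M : nat) (N : network R r M)
    (gamma0 : 'rV[R]_r) (rho : R)
    (r_ge1 : (1 <= r)%N)
    (A1 : slackness N)
    (A2 : optimal_mixture N)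
    (gamma0_max : argmax (@nonneg_orthant R r) (dual0 N) gamma0)
    (A3 : argmax setT (dual0 N) = [set gamma0])
    (rho_gt0 : 0 < rho)
    (g0_polyhedral : polyhedral (dual0 N) gamma0 rho) :
  exists C : R,
    forall (V : R) (theta : 'rV[R]_r)
      (d : measure_display) (T : measurableType d) (P : probability T R)
      (F : nat -> set_system T) (S : nat -> T -> 'I_M)
      (x : nat -> T -> action N) (beta : nat -> T -> 'rV[R]_r),
      1 <= V ->
      (forall j, 0 < theta 0 j) ->
      olac P V theta F S x beta ->
      countable_state_space P (backlog theta S x beta) ->
      {ae P, forall w : T,
        (`|qav P S x - (\sum_(j < r) theta 0 j)%:E| <= C%:E)%E}.
Proof.
(* Any action of the mixture in A2 is feasible, so the infima defining the dual functions range over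
   nonempty sets. *)
have feasible_neq0 i : @feasible R r M N i !=set0.
  have [vartheta [y [mix _ _]]] := A2.
  by have [fy _ _] := mix i; exists (y i 0%N).
pose rho1 := rho / r%:R.
(* The constant is fixed before V, [theta] and the probability space, from the l1 slope [rho1] alone
   and the network data. *)
exists (drift_constant N rho1 / (2 * rho1) + 1) => V theta d T P F S x beta V1 theta0 H _.
have V0 : 0 < V := lt_le_trans ltr01 V1.
(* The time average is built from expectations and does not depend on [w], so the almost sure claim
   is a deterministic one, with sharp maximizer [V *: gamma0]. *)
apply: aeW => w; apply: (qav_near_theta _ _ F _ _ _ V _ (V *: gamma0) _ _ _ _ _ _ beta) => //.
- by case: H.
- by move=> j; exact: ltW.
- by move=> j; rewrite mxE mulr_ge0 ?(ltW V0) //; case: gamma0_max => + _; exact.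
- by rewrite divr_gt0 // ltr0n.
- by move=> b; apply: l1_polyhedral => //; exact: ltW.
Qed.
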